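(* Assume that the matrix $\mathbb B=\begin{bmatrix}b_{1,1}&b_{1,2}\\ b_{2,1}&b_{2,2}\end{bmatrix}$ is positive semi-definite. Then on each coupling window $\tilde n$, solutions of the multirate DGiT equations (S), (V), (T), (F) of the context with $g_1=0=g_2$ satisfy $$\sum_{i=1,2}\;-\sum_{n=1}^{M_i}\int_{I_i^n}\left(F_i^{\tilde n},u_i^n\right)_\Gamma dt\;\le\;0 .$$
   Context: Positive semi-definite means $x^\top\mathbb Bx\ge0$ for all $x\in\mathbb R^2$ (symmetry is not assumed). Spatial setting. Let $d\in\{2,3\}$, $\Gamma=(0,1)^{d-1}\times\{0\}\subset\mathbb R^d$, $\Omega_1=(0,1)^{d-1}\times(0,1)$, $\Omega_2=(0,1)^{d-1}\times(-1,0)$, $\Gamma_i=\partial\Omega_i\setminus\Gamma$, with unit outward normal $\mathbf n_i$ on $\partial\Omega_i$. For $i=1,2$: $\nu_i>0$ is constant, $\mathbf s_i:\overline{\Omega_i}\to\mathbb R^d$ is a steady advection field with $\mathbf n_i\cdot\mathbf s_i=0$ on $\partial\Omega_i$, $f_i$ is a forcing on $\Omega_i\times(0,t_f]$, $g_i$ is a forcing on $\Gamma\times(0,t_f]$, and $b_{i,j}$ are real constants. Let $\tau_i$ be a conforming regular mesh of $\Omega_i$ (triangles or quadrilaterals if $d=2$, tetrahedra or parallelepipeds if $d=3$); the two meshes coincide on $\Gamma$ and induce a partition $\tau_\Gamma$ of $\Gamma$. For a fixed integer $k\ge1$, $U_i$ is the space of continuous functions on $\overline{\Omega_i}$ that are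 in $\mathbb P_k$ on each cell (tensor-product polynomials on quadrilaterals/parallelepipeds) and vanish on $\Gamma_i$; $U_\Gamma$ is the analogous space on $\overline\Gamma$ with respect to $\tau_\Gamma$, vanishing on $\partial\Gamma$ (the trace space of $U_1$ and of $U_2$). Nodal bases are $\{\phi_{i,j}\}_{j=1}^{d_{\Omega_i}}$ and $\{\mu_j\}_{j=1}^{d_\Gamma}$. Write $(v,w)=\int_{\Omega_i}vw\,dx$, $(\mu,\lambda)_\Gamma=\int_\Gamma\mu\lambda\,d\Gamma$ (traces understood), and $L(v,w)=\int_{\Omega_i}\nu_i\nabla v\cdot\nabla w\,dx+\int_{\Omega_i}\nabla\cdot(\mathbf s_iv)\,w\,dx$. Time setting. $N\in\mathbb N$, $\Delta t=t_f/N$, $t^{\tilde n}=\tilde n\Delta t$, $I^{\tilde n}=(t^{\tilde n-1},t^{\tilde n})$; $[t^{\tilde n-1},t^{\tilde n}]$ is coupling window $\tilde n$. For $i=1,2$, $M_i\in\mathbb N$, $\Delta t_i=\Delta t/M_i$; on window $\tilde n$, $t_i^n=t^{\tilde n-1}+n\Delta t_i$ and $I_i^n=(t_i^{n-1},t_i^n)$. $\mathcal U_i^n(q)$ is the space of functions $\sum_jv_j(t)\phi_{i,j}(x)$ with $v_j\in\mathbb P_q(I_i^n)$; $\mathcal V^{\tilde n}(r)$ is the space of functions $\sum_j\lambda_j(t)\mu_j(x)$ with $\lambda_j\in\mathbb P_r(I^{\tilde n})$. Polynomials in time are extended to all of $\mathbb R$ when evaluated outside their interval. Multirate DGiT method.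 Parameters: integers $q\ge0$, $0\le n_s\le q+1$, $k_s\ge0$, $r_1,r_2\ge0$, values $-\infty<\theta_1<\dots<\theta_{n_s}\le1$, and an $n_s\times(k_s+1)$ real matrix $\mathbb D$. On window $\tilde n$ the unknowns are $u_i^n\in\mathcal U_i^n(q)$ and side values $U_i^n\in U_i$ (approximating $u_i(t_i^n)$) for $1\le n\le M_i$, and $u_{\Gamma,i}^{\tilde n},F_i^{\tilde n}\in\mathcal V^{\tilde n}(r_i)$, $i=1,2$; $U_i^m$ with $m\le0$ are side values at time $t_i^m$ known from earlier windows or initialization. The equations are (S) $u_i^n(t_i^{n-1}+\theta_k\Delta t_i)=\sum_{l=1}^{k_s+1}(\mathbb D)_{k,l}U_i^{n+1-l}$, $1\le k\le n_s$ (no condition if $n_s=0$); (V) $(U_i^n,v(t_i^n))-\int_{I_i^n}(u_i^n,\dot v)\,dt=(U_i^{n-1},v(t_i^{n-1}))-\int_{I_i^n}\big[L(u_i^n,v)+(F_i^{\tilde n},v)_\Gamma-(f_i,v)\big]dt$ for all $v\in\mathcal U_i^n(q+1-n_s)$; (T) $\int_{I^{\tilde n}}(u_{\Gamma,i}^{\tilde n},\lambda)_\Gamma dt=\sum_{n=1}^{M_i}\int_{I_i^n}(u_i^n,\lambda)_\Gamma dt$ for all $\lambda\in\mathcal V^{\tilde n}(r_i)$; (F) $\int_{I^{\tilde n}}(F_i^{\tilde n},\lambda)_\Gamma dt=\int_{I^{\tilde n}}(b_{i,1}u_{\Gamma,1}^{\tilde n}+b_{i,2}u_{\Gamma,2}^{\tilde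 n}-g_i,\lambda)_\Gamma dt$ for all $\lambda\in\mathcal V^{\tilde n}(r_i)$. *)

(* Defs.v *)
From HB Require Import structures.
From mathcomp Require Import all_boot all_order all_algebra.
From mathcomp Require Import all_classical all_reals all_analysis.
Set Implicit Arguments.
Unset Strict Implicit.
Unset Printing Implicit Defensive.
Import Order.TTheory GRing.Theory Num.Theory.
Import numFieldNormedType.Exports.
Local Open Scope classical_set_scope.
Local Open Scope ring_scope.

(* The library has Lebesgue measure on R only.  On n.-tuple R, with its       *)
(* product sigma-algebra, it is built as the n-fold product measure.          *)
Section lebesgue_step.
Context {R : realType} {n : nat}.
Local Notation T := (measurableTypeR R).
Variable mu : {sigma_finite_measure set (n.-tuple T) -> \bar R}.

Definition tuple_cons (p : T * n.-tuple T) : n.+1.-tuple T :=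
  [tuple of p.1 :: p.2].

Let measurable_tuple_cons : measurable_fun setT tuple_cons.
Proof. exact: measurable_cons. Qed.

HB.instance Definition _ :=
  isMeasurableFun.Build _ _ _ _ tuple_cons measurable_tuple_cons.

Definition lebesgue_step :=
  pushforward (@lebesgue_measure R \x mu)%E tuple_cons.

Let step0 : lebesgue_step set0 = 0%E.
Proof. exact: measure0. Qed.

Let step_ge0 A : (0 <= lebesgue_step A)%E.
Proof. exact: measure_ge0. Qed.

Let step_sigma_additive : semi_sigma_additive lebesgue_step.
Proof. exact: measure_semi_sigma_additive. Qed.

HB.instance Definition _ := isMeasure.Build _ _ _ lebesgue_step
  step0 step_ge0 step_sigma_additive.

Let sigma_finite_lebesgue_step : sigma_finite setT lebesgue_step.
Proof.
have /sigma_finiteP[F [FT ndF mF]] := sigma_finiteT (@lebesgue_measure R).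
have /sigma_finiteP[G [GT ndG mG]] := sigma_finiteT mu.
pose H k : set (n.+1.-tuple T) :=
  (fun t : n.+1.-tuple T => thead t) @^-1` F k `&`
  (fun t : n.+1.-tuple T => [tuple of behead t]) @^-1` G k.
exists H.
  apply/seteqP; split=> // t _.
  have [i _ Fi] : (\bigcup_i F i) (thead t) by rewrite -FT.
  have [j _ Gj] : (\bigcup_i G i) [tuple of behead t] by rewrite -GT.
  exists (maxn i j) => //; split.
    by apply: (subsetPset _ _ (ndF _ _ _)) Fi; exact: leq_maxl.
  by apply: (subsetPset _ _ (ndG _ _ _)) Gj; exact: leq_maxr.
move=> k; split.
  apply: measurableI; rewrite -[X in measurable X]setTI.
    by apply: measurable_tnth => //; case: (mF k).
  by apply: measurable_behead => //; case: (mG k).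
rewrite /lebesgue_step /pushforward.
have bE (x : R) (t : n.-tuple T) : [tuple of behead (tuple_cons (x, t))] = t.
  exact/val_inj.
rewrite (_ : _ @^-1` _ = F k `*` G k); last first.
  by apply/seteqP; split=> -[x t]; rewrite /H /= bE theadE.
rewrite product_measure1E; [|by case: (mF k)|by case: (mG k)].
rewrite lte_mul_pinfty//; last by case: (mG k).
by rewrite ge0_fin_numE//; case: (mF k).
Qed.

HB.instance Definition _ :=
  Measure_isSigmaFinite.Build _ _ _ lebesgue_step sigma_finite_lebesgue_step.

End lebesgue_step.

Fixpoint lebesgue_tuple (R : realType) (n : nat) :
    {sigma_finite_measure set (n.-tuple (measurableTypeR R)) -> \bar R} :=
  if n is n'.+1 then lebesgue_step (lebesgue_tuple R n')
  else \d_([tuple] : 0.-tuple (measurableTypeR R)).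

Section euclidean.
Context {R : realType}.
Implicit Types n : nat.

Definition row_of_tuple n (t : n.-tuple R) : 'rV[R]_n := \row_j tnth t j.

Definition integral_rV n (A : set 'rV[R]_n) (f : 'rV[R]_n -> R) : R :=
  \int[lebesgue_tuple R n]_(t in @row_of_tuple n @^-1` A) f (row_of_tuple t).

Definition integral_time (a b : R) (h : R -> R) : R :=
  \int[@lebesgue_measure R]_(t in `]a, b[) h t.

Definition inner_L2 n (A : set 'rV[R]_n) (v w : 'rV[R]_n -> R) : R :=
  integral_rV A (fun x => v x * w x).

Definition dot n (x y : 'rV[R]_n) : R := \sum_j x 0 j * y 0 j.

Definition grad n (v : 'rV[R]_n -> R) (x : 'rV[R]_n) : 'rV[R]_n :=
  \row_j 'D_(delta_mx 0 j) v x.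

Definition div n (w : 'rV[R]_n -> 'rV[R]_n) (x : 'rV[R]_n) : R :=
  \sum_j 'D_(delta_mx 0 j) (fun y => w y 0 j) x.

(* Finite element functions are differentiable off the mesh skeleton, a null  *)
(* set, so the values of 'D on the skeleton do not affect these integrals.    *)
Definition advection_diffusion n (A : set 'rV[R]_n) (nu : R)
    (s : 'rV[R]_n -> 'rV[R]_n) (v w : 'rV[R]_n -> R) : R :=
  integral_rV A (fun x => nu * dot (grad v x) (grad w x)) +
  integral_rV A (fun x => div (fun y => v y *: s y) x * w x).

Definition boundary n (A : set 'rV[R]_n) : set 'rV[R]_n :=
  closure A `\` interior A.

Definition outer_normal n (A : set 'rV[R]_n) (x nx : 'rV[R]_n) : Prop :=
  dot nx nx = 1 /\ forall y, A y -> dot nx (y - x) <= 0.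

(* Meant for convex A.  Uniqueness of nx excludes the edges and corners,      *)
(* where no normal vector is defined.                                         *)
Definition outward_unit_normal n (A : set 'rV[R]_n) (x nx : 'rV[R]_n) : Prop :=
  [/\ boundary A x, outer_normal A x nx &
      forall nx', outer_normal A x nx' -> nx' = nx].

Definition positive_semidefinite (B : 'M[R]_2) : Prop :=
  forall x : 'cV[R]_2, 0 <= (x^T *m B *m x) 0 0.

End euclidean.

(* The dimension of the interface is m = d - 1 and the ambient dimension is   *)
(* m + 1; a point of R^(m+1) is row_mx y z with y : 'rV_m and z : 'rV_1.      *)
(* The interface Gamma is parametrized by y in (0,1)^m.                       *)
Section domains.
Context {R : realType} {m : nat}.

Definition open_cube : set 'rV[R]_m := [set y | forall j, 0 < y 0 j < 1].

(* The subdomains are numbered 0 and 1. *)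
Definition Omega (i : 'I_2) : set 'rV[R]_(m + 1) :=
  [set x | open_cube (lsubmx x) /\
           if i == 0 then 0 < rsubmx x 0 0 < 1 else -1 < rsubmx x 0 0 < 0].

Definition Gamma : set 'rV[R]_(m + 1) :=
  [set x | open_cube (lsubmx x) /\ rsubmx x = 0].

Definition outer_boundary (i : 'I_2) : set 'rV[R]_(m + 1) :=
  boundary (Omega i) `\` Gamma.

Definition on_Gamma (y : 'rV[R]_m) : 'rV[R]_(m + 1) := row_mx y 0.

Definition trace (v : 'rV[R]_(m + 1) -> R) : 'rV[R]_m -> R := v \o on_Gamma.

End domains.
Arguments open_cube : clear implicits.
Arguments Omega : clear implicits.
Arguments outer_boundary : clear implicits.

Section finite_elements.
Context {R : realType}.
Implicit Types n k : nat.

(* A cell is given by its vertices.  A tensor cell is the image of the unit   *)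
(* cube under the map, of degree 1 in each variable, that sends the vertices  *)
(* a in {0,1}^n of the cube to P a: a segment if n = 1, a quadrilateral or a  *)
(* parallelepiped under the conditions in [regular_cell].                     *)
Inductive cell n :=
| Simplex of 'I_n.+1 -> 'rV[R]_n
| TensorCell of {ffun 'I_n -> bool} -> 'rV[R]_n.

Definition unit_cube n : set 'rV[R]_n := [set x | forall j, 0 <= x 0 j <= 1].
Arguments unit_cube n : clear implicits.

Definition multilinear n (P : {ffun 'I_n -> bool} -> 'rV[R]_n)
    (x : 'rV[R]_n) : 'rV[R]_n :=
  \sum_(a : {ffun 'I_n -> bool})
    (\prod_j (if a j then x 0 j else 1 - x 0 j)) *: P a.

Definition cell_set n (K : cell n) : set 'rV[R]_n :=
  match K with
  | Simplex P => [set x | exists w : 'I_n.+1 -> R,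
      [/\ forall j, 0 <= w j, \sum_j w j = 1 & x = \sum_j w j *: P j]]
  | TensorCell P => multilinear P @` unit_cube n
  end.

(* For n = 2 the Jacobian condition holds exactly when the vertices are those *)
(* of a non-degenerate convex quadrilateral in cyclic order.                  *)
Definition regular_cell n (K : cell n) : Prop :=
  match K with
  | Simplex P => (\matrix_(j < n) (P (lift ord0 j) - P ord0)) \in unitmx
  | TensorCell P =>
      (forall x, unit_cube n x -> 'J (multilinear P) x \in unitmx) /\
      (n = 2%N \/ exists p (E : 'M[R]_n), forall x, multilinear P x = p + x *m E)
  end.

(* Proper faces of a convex polytope: the empty face and the sets of          *)
(* maximizers of non-zero linear forms.                                       *)
Definition proper_face n (K F : set 'rV[R]_n) : Prop :=
  F = set0 \/ exists2 l : 'rV[R]_n, l != 0 &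
    F = [set x | K x /\ forall y, K y -> dot l y <= dot l x].

Definition conforming_mesh n (A : set 'rV[R]_n) N (tau : 'I_N -> cell n) :
    Prop :=
  [/\ forall a, regular_cell (tau a),
      closure A = \bigcup_(a in setT) cell_set (tau a) &
      forall a b, a != b ->
        let F := cell_set (tau a) `&` cell_set (tau b) in
        proper_face (cell_set (tau a)) F /\ proper_face (cell_set (tau b)) F].

(* tauG lists the intersections with the closure of Gamma of the cells of     *)
(* tau that have a facet on Gamma.                                            *)
Definition induced_partition m N (tau : 'I_N -> cell (m + 1))
    NG (tauG : 'I_NG -> cell m) : Prop :=
  (forall e, regular_cell (tauG e)) /\
  range (fun e => cell_set (tauG e)) =
  [set S | (exists a, S = on_Gamma @^-1` cell_set (tau a)) /\
           interior S !=set0].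

Definition monomial n k (a : {ffun 'I_n -> 'I_k.+1}) (x : 'rV[R]_n) : R :=
  \prod_j x 0 j ^+ a j.

Definition total_degree_poly n k (p : 'rV[R]_n -> R) : Prop :=
  exists c : {ffun 'I_n -> 'I_k.+1} -> R,
    forall x, p x = \sum_(a : {ffun 'I_n -> 'I_k.+1} | (\sum_j a j <= k)%N)
                      c a * monomial a x.

Definition tensor_poly n k (p : 'rV[R]_n -> R) : Prop :=
  exists c : {ffun 'I_n -> 'I_k.+1} -> R,
    forall x, p x = \sum_a c a * monomial a x.

(* On tensor cells the polynomials are taken in reference coordinates. *)
Definition poly_on_cell n k (K : cell n) (v : 'rV[R]_n -> R) : Prop :=
  match K with
  | Simplex P => exists2 p, total_degree_poly k p &
      forall x, cell_set K x -> v x = p x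
  | TensorCell P => exists2 p, tensor_poly k p &
      forall x, unit_cube n x -> v (multilinear P x) = p x
  end.

(* Functions on the closure of A are represented by total functions, whose    *)
(* values elsewhere are irrelevant; Z is the set where they vanish.           *)
Definition fe_space n (A Z : set 'rV[R]_n) N (tau : 'I_N -> cell n) k :
    set ('rV[R]_n -> R) :=
  [set v | [/\ {within closure A, continuous v},
               forall a, poly_on_cell k (tau a) v &
               forall x, Z x -> v x = 0]].

(* Linear independence follows from duality with the nodes. *)
Definition nodal_basis n (A : set 'rV[R]_n) (V : set ('rV[R]_n -> R))
    D (phi : 'I_D -> 'rV[R]_n -> R) : Prop :=
  [/\ forall j, V (phi j),
      forall v, V v -> exists c : 'I_D -> R,
        forall x, closure A x -> v x = \sum_j c j * phi j x &
      exists2 node : 'I_D -> 'rV[R]_n, (forall j, closure A (node j)) &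
        forall j l, phi j (node l) = (j == l)%:R].

(* Polynomials in time of degree at most q with values in the span of phi,    *)
(* defined for all times.                                                     *)
Definition space_time n (A : set 'rV[R]_n) D (phi : 'I_D -> 'rV[R]_n -> R)
    (q : nat) : set (R -> 'rV[R]_n -> R) :=
  [set w | exists2 p : 'I_D -> {poly R}, (forall j, (size (p j) <= q.+1)%N) &
     forall t x, closure A x -> w t x = \sum_j (p j).[t] * phi j x].

End finite_elements.
Arguments cell : clear implicits.

Section dgit.
Context {R : realType} {m : nat}.
Local Notation Rd := 'rV[R]_(m + 1).
Local Notation inner_Gamma := (inner_L2 (open_cube R m)).

Definition window_time (dt : R) (nw : nat) : R := nw%:R * dt.

(* t_i^n on window nw >= 1, with M substeps *)
Definition sub_time (dt : R) (M nw n : nat) : R :=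
  window_time dt nw.-1 + n%:R * (dt / M%:R).

(* The column index l of Dm starts at 0, so that the paired side value has    *)
(* index n - l.                                                               *)
Definition eq_S (A : set Rd) (ns ks : nat) (theta : 'I_ns -> R)
    (Dm : 'M[R]_(ns, ks.+1)) (t0 dti : R) (n : nat)
    (un : R -> Rd -> R) (U : int -> Rd -> R) : Prop :=
  forall k x, closure A x ->
    un (t0 + theta k * dti) x = \sum_l Dm k l * U (n%:Z - l%:Z) x.

(* [t0, t1] is the substep, U0 and U1 the side values at its end points.      *)
Definition eq_V (A : set Rd) (nu : R) (s : Rd -> Rd) (f : R -> Rd -> R)
    (V : set (R -> Rd -> R)) (t0 t1 : R) (un : R -> Rd -> R) (U0 U1 : Rd -> R)
    (F : R -> 'rV[R]_m -> R) : Prop :=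
  forall v, V v ->
    inner_L2 A U1 (v t1) -
      integral_time t0 t1
        (fun t => inner_L2 A (un t) (fun x => derive1 (fun r => v r x) t)) =
    inner_L2 A U0 (v t0) -
      integral_time t0 t1
        (fun t => advection_diffusion A nu s (un t) (v t) +
                  inner_Gamma (F t) (trace (v t)) - inner_L2 A (f t) (v t)).

Definition eq_T (V : set (R -> 'rV[R]_m -> R)) (dt : R) (M nw : nat)
    (u : nat -> R -> Rd -> R) (uG : R -> 'rV[R]_m -> R) : Prop :=
  forall lam, V lam ->
    integral_time (window_time dt nw.-1) (window_time dt nw)
      (fun t => inner_Gamma (uG t) (lam t)) =
    \sum_(1 <= n < M.+1)
      integral_time (sub_time dt M nw n.-1) (sub_time dt M nw n)
        (fun t => inner_Gamma (trace (u n t)) (lam t)).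

Definition eq_F (V : set (R -> 'rV[R]_m -> R)) (dt : R) (nw : nat)
    (b : 'I_2 -> R) (g : R -> 'rV[R]_m -> R)
    (uG : 'I_2 -> R -> 'rV[R]_m -> R) (F : R -> 'rV[R]_m -> R) : Prop :=
  forall lam, V lam ->
    integral_time (window_time dt nw.-1) (window_time dt nw)
      (fun t => inner_Gamma (F t) (lam t)) =
    integral_time (window_time dt nw.-1) (window_time dt nw)
      (fun t => inner_Gamma
        (fun y => b 0 * uG 0 t y + b 1 * uG 1 t y - g t y) (lam t)).

End dgit.

(* Main.v *)
Require Import Defs.
From mathcomp Require Import all_boot all_order all_algebra.
From mathcomp Require Import all_classical all_reals all_analysis.
From mathcomp Require Import measurable_realfun ring.
Import Order.TTheory GRing.Theory Num.Theory.
Import numFieldNormedType.Exports.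
Local Open Scope classical_set_scope.
Local Open Scope ring_scope.

(** Write u_i for the side-i solution, uG_i for its L2-in-time projection on the
    interface and F_i for the flux.  Both F_i and uG_i lie in the test space of
    the interface equations.  Testing [eq_T] with F_i replaces the substep
    integrals of (F_i, u_i) by the window integral of (F_i, uG_i); testing
    [eq_F] with uG_i then replaces F_i by G_i = b_i0 uG_0 + b_i1 uG_1, the
    forcing being zero.  The quantity to bound is therefore
      - int [(G_0, uG_0) + (G_1, uG_1)] dt,
    and at every time and every point of the interface the integrand
    sum_ij b_ij uG_j uG_i is nonnegative because B is positive semi-definite.

    What takes work is that the sum over i may be moved under the integral
    signs, since the Lebesgue integral is additive on integrable functions only.
    - In space, a basis function is continuous on the closed unit cube, hence
      bounded; it is measurable for the product sigma-algebra because an open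
      set of R^n is a countable union of boxes ([measurable_open_tuple]); and
      the cube has measure 1.  This gives [integrable_open_cubeM].
    - In time, the L2 product of two functions that are polynomial in time is
      itself a polynomial ([inner_L2_space_time]), hence integrable on a
      bounded interval. *)

(** * Measurability and integrability on the open cube *)

Section space_integrals.
Context {R : realType}.
Implicit Types n : nat.

Lemma measurable_ball_tuple n (c : 'rV[R]_n) (e : R) :
  measurable (@row_of_tuple R n @^-1` ball c e).
Proof.
have [e0|e0] := ltP 0 e; last first.
  rewrite (_ : _ @^-1` _ = set0) //; apply/seteqP; split=> // t /=.
  by case; rewrite ltNge e0.
rewrite (_ : _ @^-1` _ = \bigcap_(j : 'I_n)
    (fun t : n.-tuple (measurableTypeR R) => tnth t j) @^-1` ball (c 0 j) e).
  apply: fin_bigcap_measurable => // j _.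
  rewrite -[X in measurable X]setTI; apply: measurable_tnth => //.
  exact: measurable_ball.
apply/seteqP; split=> t /=.
  by move=> -[_ h] j _; have := h 0 j; rewrite mxE.
move=> h; split=> // i j; rewrite ord1 mxE; exact: h.
Qed.

(** An open set is the union of the balls contained in it that have a rational
    center and a radius 1/(k+1).  In the sup norm these balls are boxes, so
    they are measurable, and there are countably many of them. *)
Lemma measurable_open_tuple n (O : set 'rV[R]_n) :
  open O -> measurable (@row_of_tuple R n @^-1` O).
Proof.
move=> oO.
pose rat_ball (p : {ffun 'I_n -> rat} * nat) : set 'rV[R]_n :=
  ball (\row_j ratr (p.1 j) : 'rV[R]_n) p.2.+1%:R^-1.
pose inner p := if `[< rat_ball p `<=` O >] then rat_ball p else set0.
rewrite (_ : O = \bigcup_p inner p); last first.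
  apply/seteqP; split=> [x Ox|x [p _]]; last first.
    by rewrite /inner; case: asboolP => // pO /pO.
  have [e /= e0 xeO] : nbhs_ball x O.
    by apply/nbhs_ballP; move: oO; rewrite openE => /(_ _ Ox).
  (* A ball of radius 1/(k+1) < e/2 that contains x lies in the e-ball at x. *)
  have [k ke] : exists k, k.+1%:R^-1 < e / 2.
    have e20 : 0 < e / 2 by rewrite divr_gt0.
    have [k _ ke] := near_infty_natSinv_lt (PosNum e20).
    by exists k; exact: ke (leqnn k).
  have k0 : 0 < k.+1%:R^-1 :> R by rewrite invr_gt0.
  have near_rat j : exists y : rat, ball (x 0 j) k.+1%:R^-1 (ratr y : R).
    have /rat_in_itvoo[y /itvP yx] : x 0 j < x 0 j + k.+1%:R^-1.
      by rewrite ltrDl.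
    exists y; rewrite /ball /= distrC ger0_norm ?subr_ge0 ?yx//.
    by rewrite ltrBlDl yx.
  have [c cx] := choice near_rat.
  exists ([ffun j => c j], k) => //; rewrite /inner.
  have cxk i j : ball (x i j) k.+1%:R^-1 ((\row_l ratr (c l) : 'rV[R]_n) i j).
    by rewrite ord1 mxE.
  have rbE : rat_ball ([ffun j => c j], k) =
      ball (\row_l ratr (c l) : 'rV[R]_n) k.+1%:R^-1.
    by congr ball; apply/rowP => j; rewrite !mxE ffunE.
  rewrite rbE; case: asboolP => [_|]; first by apply: ball_sym; split.
  case=> y cy; apply: xeO; rewrite [e]splitr.
  apply: (@ball_triangle _ _ (\row_l ratr (c l) : 'rV[R]_n)); last first.
    exact: le_ball (ltW ke) _ cy.
  by apply: le_ball (ltW ke) _ _; split.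
rewrite preimage_bigcup; apply: countable_bigcupT_measurable => // p.
rewrite /inner; case: asboolP => _; last by rewrite preimage_set0.
exact: measurable_ball_tuple.
Qed.

Lemma measurable_fun_continuous_tuple n (D : set 'rV[R]_n) (f : 'rV[R]_n -> R) :
  open D -> {within D, continuous f} ->
  measurable_fun (@row_of_tuple R n @^-1` D) (f \o @row_of_tuple R n).
Proof.
move=> oD cf mD.
apply: (measurability _ (RGenOpens.measurableE R)) => //.
move=> _ [_ [a [b ->] <-]].
apply: (measurable_open_tuple n (D `&` f @^-1` `]a, b[)).
have /open_subspaceP[V oV VD] := (@continuousP (subspace D) R f).1 cf
  _ (@interval_open R (BRight a) (BLeft b) isT isT).
by rewrite setIC -VD; exact: openI.
Qed.

Lemma open_open_cube n : open (open_cube R n).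
Proof.
rewrite openE => x cx.
have : \forall y \near x, forall j, 0 < (y : 'rV[R]_n) 0 j < 1.
  apply: (@filter_forall _ _ (fun j (y : 'rV[R]_n) => 0 < y 0 j < 1)
    (nbhs x)) => j.
  have /(_ `]0, 1[%classic) := @coord_continuous R 1 n 0 j x.
  have x01 : nbhs (x 0 j) (`]0, 1[%classic : set R).
    apply: open_nbhs_nbhs; split; first exact: interval_open.
    by rewrite /= in_itv; exact: cx.
  move=> /(_ x01); rewrite nbhs_simpl /=; apply: filterS => y.
  by rewrite /= in_itv.
by [].
Qed.

(** The (n+1)-cube is the product of ]0, 1[ and the n-cube under the map that
    defines the measure in dimension n+1. *)
Lemma lebesgue_tuple_open_cube n :
  lebesgue_tuple R n (@row_of_tuple R n @^-1` open_cube R n) = 1%E.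
Proof.
elim: n => [|n IH] /=.
  rewrite diracE mem_set//= => -[].
by case.
rewrite /lebesgue_step /pushforward.
rewrite (_ : _ @^-1` _ = `]0, 1[%classic `*`
    (@row_of_tuple R n @^-1` open_cube R n)); last first.
  apply/seteqP; split=> -[x t] /=.
    move=> h; split.
      by have := h ord0; rewrite mxE /= in_itv.
    move=> j; rewrite mxE; have := h (lift ord0 j); rewrite mxE.
    by rewrite tnthS.
  rewrite in_itv => -[/= h1 h2] j; rewrite mxE.
  case: (unliftP ord0 j) => [i ->|-> //].
  by have := h2 i; rewrite mxE tnthS.
have mcube : measurable (@row_of_tuple R n @^-1` open_cube R n).
  exact: measurable_open_tuple (open_open_cube n).
rewrite product_measure1E//= IH mule1.
have := @lebesgue_measure_itv R `]0, 1[%R.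
by rewrite /= lte_fin ltr01 sube0.
Qed.

Lemma compact_closure_open_cube n : compact (closure (open_cube R n)).
Proof.
have K : compact [set x : 'rV[R]_n | forall j, `[0, 1]%classic (x ord0 j)].
  apply: (@rV_compact R n (fun=> `[0, 1]%classic)) => _.
  exact: segment_compact.
apply: (subclosed_compact _ K); first exact: closed_closure.
have Kc := compact_closed (@norm_hausdorff _ _) K.
rewrite [X in _ `<=` X](closure_id _).1//; apply: closureS => x cx j /=.
by rewrite in_itv /=; case/andP: (cx j) => /ltW -> /ltW ->.
Qed.

(** Continuity up to the boundary, rather than on the open cube alone, provides
    the bound, by compactness. *)
Lemma integrable_open_cube n (v : 'rV[R]_n -> R) :
  {within closure (open_cube R n), continuous v} ->
  (lebesgue_tuple R n).-integrable (@row_of_tuple R n @^-1` open_cube R n)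
    (EFin \o (v \o @row_of_tuple R n)).
Proof.
move=> cv; have oc := open_open_cube n.
apply: measurable_bounded_integrable; first exact: measurable_open_tuple.
- by rewrite [X in (X < _)%E](lebesgue_tuple_open_cube n) ltry.
- apply: measurable_fun_continuous_tuple => //.
  exact: continuous_subspaceW (@subset_closure _ _) cv.
- have [M [Mr vM]] :=
    compact_bounded (continuous_compact cv (compact_closure_open_cube n)).
  exists M; split=> // y My t ct; apply: (vM y My).
  by exists (row_of_tuple t) => //; exact: subset_closure.
Qed.

Lemma integrable_open_cubeM n (v w : 'rV[R]_n -> R) :
  {within closure (open_cube R n), continuous v} ->
  {within closure (open_cube R n), continuous w} ->
  (lebesgue_tuple R n).-integrable (@row_of_tuple R n @^-1` open_cube R n)
    (fun t => (v (row_of_tuple t) * w (row_of_tuple t))%:E).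
Proof.
move=> cv cw; apply: (integrable_open_cube n (fun x => v x * w x)).
by move=> x; apply: cvgM; [exact: cv|exact: cw].
Qed.

Lemma Rintegral_lin_comb d (T : measurableType d)
    (la : {measure set T -> \bar R}) (D : set T) (I : finType) (c : I -> R)
    (f : I -> T -> R) :
  measurable D -> (forall i, la.-integrable D (EFin \o f i)) ->
  \int[la]_(x in D) (\sum_i c i * f i x) = \sum_i c i * \int[la]_(x in D) f i x.
Proof.
move=> mD fi; rewrite {1}/Rintegral.
under eq_integral do rewrite -sumEFin.
have cfi i : la.-integrable D (fun x => (c i * f i x)%:E).
  under [X in _.-integrable _ X]eq_fun do rewrite EFinM.
  exact: (integrableZl mD (c i) (fi i)).
rewrite integral_sum//.
rewrite (eq_bigr (fun i => (c i * \int[la]_(x in D) f i x)%:E)) => [|i _].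
  by rewrite sumEFin.
rewrite -RintegralZl// /Rintegral fineK//; exact: integrable_fin_num.
Qed.

(** * Functions polynomial in time *)

(** Expanding both functions on the basis, the coefficients of the polynomial
    are sums of products of time coefficients with entries of the mass matrix
    of the basis. *)
Lemma inner_L2_space_time n N (mu : 'I_N -> 'rV[R]_n -> R) q q' w z :
  (forall j, {within closure (open_cube R n), continuous (mu j)}) ->
  space_time (open_cube R n) mu q w -> space_time (open_cube R n) mu q' z ->
  exists P : {poly R}, forall t, inner_L2 (open_cube R n) (w t) (z t) = P.[t].
Proof.
move=> cmu [p _ wE] [p' _ zE].
exists (\sum_(a : 'I_N * 'I_N)
  p a.1 * p' a.2 * (inner_L2 (open_cube R n) (mu a.1) (mu a.2))%:P) => t.
rewrite horner_sum; under eq_bigr do rewrite !hornerE.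
rewrite -[RHS]Rintegral_lin_comb; last first.
- by move=> a; exact: integrable_open_cubeM.
- exact: measurable_open_tuple (open_open_cube n).
apply: eq_Rintegral => x /set_mem /= /(@subset_closure _ _) cx.
rewrite wE// zE// big_distrlr /= pair_big /=.
by apply: eq_bigr => a _; rewrite mulrACA.
Qed.

Lemma space_time_continuous n (A : set 'rV[R]_n) N (mu : 'I_N -> 'rV[R]_n -> R)
    q w t :
  (forall j, {within closure A, continuous (mu j)}) -> space_time A mu q w ->
  {within closure A, continuous (w t)}.
Proof.
move=> cmu [p _ wE].
apply: (@subspace_eq_continuous _ _ _ (fun x => \sum_j (p j).[t] * mu j x)).
  by move=> x /set_mem Ax; rewrite -wE.
move=> x; apply: cvg_big => [|j _]; first exact: add_continuous.
by apply: cvgM; [exact: cvg_cst|exact: cmu].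
Qed.

Lemma space_time_linear_comb n (A : set 'rV[R]_n) N (mu : 'I_N -> 'rV[R]_n -> R)
    q q' (a b : R) w z :
  space_time A mu q w -> space_time A mu q' z ->
  space_time A mu (maxn q q') (fun t x => a * w t x + b * z t x).
Proof.
move=> [p sp wE] [p' sp' zE].
exists (fun j => a *: p j + b *: p' j) => [j|t x Ax].
  apply: leq_trans (size_polyD _ _) _; rewrite geq_max.
  rewrite !(leq_trans (size_scale_leq _ _))//.
    by rewrite (leq_trans (sp' j))// ltnS leq_maxr.
  by rewrite (leq_trans (sp j))// ltnS leq_maxl.
rewrite wE// zE// !mulr_sumr -big_split; apply: eq_bigr => j _ /=.
by rewrite hornerD !hornerZ mulrDl !mulrA.
Qed.

Lemma inner_L2C n (A : set 'rV[R]_n) v w : inner_L2 A v w = inner_L2 A w v.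
Proof. by apply: eq_Rintegral => t _; rewrite mulrC. Qed.

Lemma integrable_horner (P : {poly R}) (a b : R) :
  lebesgue_measure.-integrable `]a, b[ (fun t => P.[t]%:E).
Proof.
have := @continuous_compact_integrable R (horner P) `[a, b]
  (@segment_compact R a b).
move=> /(_ (continuous_subspaceT (@continuous_horner R P))).
apply: integrableS => //; exact: subset_itv_oo_cc.
Qed.

(** * The coupling terms *)

Lemma positive_semidefinite_form_ge0 (B : 'M[R]_2) (x : 'I_2 -> R) :
  positive_semidefinite B ->
  0 <= (B 0 0 * x 0 + B 0 1 * x 1) * x 0 + (B 1 0 * x 0 + B 1 1 * x 1) * x 1.
Proof.
move=> /(_ (\col_i x i)).
have l1 : lift ord0 ord0 = 1 :> 'I_2 by exact/val_inj.
have o0 : ord0 = 0 :> 'I_2 by exact/val_inj.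
rewrite !mxE !big_ord_recl big_ord0 !mxE !big_ord_recl !big_ord0 !mxE !l1 !o0.
by congr (0 <= _); ring.
Qed.
End space_integrals.
Theorem theorem2 (R : realType) (m : nat)
  (hd : (m + 1)%N = 2%N \/ (m + 1)%N = 3%N)
  (* continuous problem *)
  (nu : 'I_2 -> R) (hnu : forall i, 0 < nu i)
  (s : 'I_2 -> 'rV[R]_(m + 1) -> 'rV[R]_(m + 1))
  (hs : forall i x nx,
     outward_unit_normal (Omega R m i) x nx -> dot nx (s i x) = 0)
  (tf : R) (htf : 0 < tf)
  (f : 'I_2 -> R -> 'rV[R]_(m + 1) -> R)
  (g : 'I_2 -> R -> 'rV[R]_m -> R)
  (hg : forall i (t : R) y, 0 < t <= tf -> open_cube R m y -> g i t y = 0)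
  (B : 'M[R]_2) (hB : positive_semidefinite B)
  (* meshes and finite element spaces *)
  (ncell : 'I_2 -> nat)
  (tau : forall i, 'I_(ncell i) -> cell R (m + 1))
  (htau : forall i, conforming_mesh (Omega R m i) (tau i))
  (nfacet : nat) (tauG : 'I_nfacet -> cell R m)
  (htauG : forall i, induced_partition (tau i) tauG)
  (k : nat) (hk : (1 <= k)%N)
  (dOmega : 'I_2 -> nat)
  (phi : forall i, 'I_(dOmega i) -> 'rV[R]_(m + 1) -> R)
  (hphi : forall i, nodal_basis (Omega R m i)
     (fe_space (Omega R m i) (outer_boundary R m i) (tau i) k) (phi i))
  (dGamma : nat) (mu : 'I_dGamma -> 'rV[R]_m -> R)
  (hmu : nodal_basis (open_cube R m)
     (fe_space (open_cube R m) (boundary (open_cube R m)) tauG k) mu)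
  (* time grids and parameters of the method *)
  (N : nat) (hN : (1 <= N)%N)
  (M : 'I_2 -> nat) (hM : forall i, (1 <= M i)%N)
  (q ns ks : nat) (hns : (ns <= q + 1)%N) (r : 'I_2 -> nat)
  (theta : 'I_ns -> R)
  (htheta : forall a b : 'I_ns, (a < b)%N -> theta a < theta b)
  (htheta1 : forall a, theta a <= 1)
  (Dm : 'M[R]_(ns, ks.+1))
  (* a solution on window nw *)
  (nw : nat) (hnw : (1 <= nw <= N)%N)
  (u : 'I_2 -> nat -> R -> 'rV[R]_(m + 1) -> R)
  (hu : forall i n, (1 <= n <= M i)%N ->
     space_time (Omega R m i) (phi i) q (u i n))
  (U : 'I_2 -> int -> 'rV[R]_(m + 1) -> R)
  (hU : forall i (z : int), z <= (M i)%:Z ->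
     fe_space (Omega R m i) (outer_boundary R m i) (tau i) k (U i z))
  (uG F : 'I_2 -> R -> 'rV[R]_m -> R)
  (huG : forall i, space_time (open_cube R m) mu (r i) (uG i))
  (hF : forall i, space_time (open_cube R m) mu (r i) (F i)) :
  let dt := tf / N%:R in
  let t i n := sub_time dt (M i) nw n in
  (forall i n, (1 <= n <= M i)%N ->
     eq_S (Omega R m i) theta Dm (t i n.-1) (dt / (M i)%:R) n (u i n) (U i)) ->
  (forall i n, (1 <= n <= M i)%N ->
     eq_V (Omega R m i) (nu i) (s i) (f i)
       (space_time (Omega R m i) (phi i) (q + 1 - ns)) (t i n.-1) (t i n)
       (u i n) (U i n.-1%:Z) (U i n%:Z) (F i)) ->
  (forall i, eq_T (space_time (open_cube R m) mu (r i)) dt (M i) nw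
     (u i) (uG i)) ->
  (forall i, eq_F (space_time (open_cube R m) mu (r i)) dt nw
     (B i) (g i) uG (F i)) ->
  \sum_(i < 2) - \sum_(1 <= n < (M i).+1)
    integral_time (t i n.-1) (t i n)
      (fun t' => inner_L2 (open_cube R m) (F i t') (trace (u i n t'))) <= 0.

Proof.
move=> dt t _ _ eT eF.
have [nw1 nwN] := andP hnw.
have dt0 : 0 < dt by rewrite divr_gt0 ?ltr0n.
have cmu j : {within closure (open_cube R m), continuous (mu j)}.
  by case: hmu => /(_ j) [].
(* The flux F_i before its projection on the test space of [eq_F]. *)
pose G i t' y := B i 0 * uG 0 t' y + B i 1 * uG 1 t' y.
have stG i : space_time (open_cube R m) mu (maxn (r 0) (r 1)) (G i).
  exact: space_time_linear_comb (huG 0) (huG 1).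
pose a := window_time dt nw.-1; pose b := window_time dt nw.
have window_gt0 t' : t' \in `]a, b[ -> 0 < t' <= tf.
  rewrite in_itv /= => /andP[at' t'b]; apply/andP; split.
    by apply: le_lt_trans at'; rewrite mulr_ge0// ltW.
  apply: le_trans (ltW t'b) _; rewrite /b /window_time.
  have -> : tf = N%:R * dt by rewrite /dt mulrC divfK// pnatr_eq0 -lt0n.
  by rewrite ler_pM2r// ler_nat.
(* [eq_T] tested with F_i, followed by [eq_F] tested with uG_i. *)
have coupling i : \sum_(1 <= n < (M i).+1) integral_time (t i n.-1) (t i n)
      (fun t' => inner_L2 (open_cube R m) (F i t') (trace (u i n t'))) =
    integral_time a b (fun t' => inner_L2 (open_cube R m) (G i t') (uG i t')).
  under eq_bigr do under [X in integral_time _ _ X]eq_fun do rewrite inner_L2C.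
  rewrite -(eT i _ (hF i)).
  under [X in integral_time _ _ X]eq_fun do rewrite inner_L2C.
  rewrite (eF i _ (huG i)).
  apply: eq_Rintegral => t' /set_mem /= t'ab.
  apply: eq_Rintegral => x /set_mem /= cx.
  by rewrite hg ?subr0//; exact: window_gt0.
under eq_bigr do rewrite coupling.
rewrite big_ord_recl big_ord1.
rewrite (_ : lift ord0 ord0 = 1); last exact/val_inj.
rewrite (_ : ord0 = 0)//.
have polyG i := inner_L2_space_time m dGamma mu _ _ _ _ cmu (stG i) (huG i).
have intG i : lebesgue_measure.-integrable `]a, b[
    (fun t' => (inner_L2 (open_cube R m) (G i t') (uG i t'))%:E).
  have [P PE] := polyG i; under [X in _.-integrable _ X]eq_fun do rewrite PE.
  exact: integrable_horner.
rewrite -opprD oppr_le0 -RintegralD//; [|exact: intG|exact: intG].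
apply: Rintegral_ge0 => t' _.
rewrite -RintegralD; first last.
- apply: integrable_open_cubeM; apply: space_time_continuous cmu _.
  + exact: stG.
  + exact: huG.
- apply: integrable_open_cubeM; apply: space_time_continuous cmu _.
  + exact: stG.
  + exact: huG.
- exact: measurable_open_tuple (open_open_cube m).
apply: Rintegral_ge0 => x _.
exact: positive_semidefinite_form_ge0 (fun i => uG i t' _) hB.
Qed.
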